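(* Let $\pi$ be a policy, let $f:\mathcal{H}\to\mathcal{W}$ be a statistic with values in a normed vector space $(\mathcal{W},\|\cdot\|)$, and suppose there is a constant $L>0$ such that for every model $\mu\in\mathcal{M}$ and all histories $x,z\in\mathcal{H}$, $$\left|\ln\frac{\mathbb{P}_\mu^\pi(z)}{\mathbb{P}_\mu^\pi(x)}\right|\le L\,\|f(z)-f(x)\|$$ (in particular these ratios are well defined, i.e. the probabilities are positive). Let $h\in\mathcal{H}$ be an observed history, let $\epsilon>0$, and let $$A_\epsilon^h=\{z\in\mathcal{H} : \|f(z)-f(h)\|\le\epsilon\},$$ with $|A_\epsilon^h|$ its cardinality. Let $\xi(\cdot\mid h)$ be the exact posterior and $\xi_\epsilon(\cdot\mid h)$ the approximate (ABC) posterior on $\mathcal{M}$ obtained from the prior $\xi$. Then $$D\big(\xi(\cdot\mid h)\,\big\|\,\xi_\epsilon(\cdot\mid h)\big)\le \ln|A_\epsilon^h|+2L\epsilon .$$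
   Context: $\mathcal{M}$ is a (measurable) set of environment models and $\xi$ is a prior probability measure on $\mathcal{M}$, not depending on the policy. $\mathcal{H}$ is a countable set of histories (sequences of observations, actions and rewards). For a model $\mu\in\mathcal{M}$ and a (possibly history-dependent) policy $\pi$, $\mathbb{P}_\mu^\pi$ is the probability measure on $\mathcal{H}$ describing the history generated when policy $\pi$ acts in environment $\mu$; $\mu\mapsto\mathbb{P}_\mu^\pi(z)$ is measurable for each $z\in\mathcal{H}$, $\mathbb{P}_\mu^\pi(z)$ denotes the probability of the single history $z$, and $\mathbb{P}_\mu^\pi(A)=\sum_{z\in A}\mathbb{P}_\mu^\pi(z)$ for $A\subset\mathcal{H}$. Exact posterior: for measurable $B\subset\mathcal{M}$, $$\xi(B\mid h)=\frac{\int_B \mathbb{P}_\mu^\pi(h)\,d\xi(\mu)}{\int_{\mathcal{M}}\mathbb{P}_\mu^\pi(h)\,d\xi(\mu)}.$$ Approximate (ABC) posterior with threshold $\epsilon$: the conditional law of $\mu$ when one draws $\mu\sim\xi$, then $z\sim\mathbb{P}_\mu^\pi$, and conditions on acceptance $\|f(z)-f(h)\|\le\epsilon$; that is, $$\xi_\epsilon(B\mid h)=\frac{\int_B \mathbb{P}_\mu^\pi(A_\epsilon^h)\,d\xi(\mu)}{\int_{\mathcal{M}}\mathbb{P}_\mu^\pi(A_\epsilon^h)\,d\xi(\mu)}.$$ The KL-divergence of probability measures $\xi,\xi'$ on $\mathcal{M}$ is $D(\xi\|\xi')=\int_{\mathcal{M}}\ln\frac{d\xi(\mu)}{d\xi'(\mu)}\,d\xi(\mu)$.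 *)

(* Defs.v *)
From HB Require Import structures.
From mathcomp Require Import all_boot all_order all_algebra.
From mathcomp Require Import all_classical all_reals all_analysis.

Set Implicit Arguments.
Unset Strict Implicit.
Unset Printing Implicit Defensive.
Import Order.TTheory GRing.Theory Num.Theory.
Import numFieldNormedType.Exports.

Local Open Scope classical_set_scope.
Local Open Scope ring_scope.

Section joint.
Local Open Scope ereal_scope.
Context d d' (M : measurableType d) (H : measurableType d') (R : realType).
Variables (xi : probability M R) (P : R.-pker M ~> H).
Variables (A : set H) (mA : measurable A).

(* Probability that the model lies in B and the generated history lies in A.
   The measurability proof makes joint a measure in B. *)
Definition joint of measurable A : set M -> \bar R :=
  fun B => \int[xi]_(mu in B) P mu A.

Let joint0 : joint mA set0 = 0.
Proof. by rewrite /joint integral_set0. Qed.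

Let joint_ge0 B : 0 <= joint mA B.
Proof. exact: integral_ge0. Qed.

Let joint_sigma_additive : semi_sigma_additive (joint mA).
Proof.
by apply: semi_sigma_additive_nng_induced => //; exact: measurable_kernel.
Qed.

HB.instance Definition _ := isMeasure.Build _ _ _ (joint mA)
  joint0 joint_ge0 joint_sigma_additive.

(* mnormalize needs a default value for zero or infinite total mass: the prior.
   By posteriorE it plays no role when A has positive marginal probability. *)
Definition posterior : probability M R := mnormalize (joint mA) xi.

Lemma posteriorE B : 0 < \int[xi]_mu P mu A ->
  posterior B = (\int[xi]_(mu in B) P mu A) / (\int[xi]_mu P mu A).
Proof.
move=> I0.
have Ioo : \int[xi]_mu P mu A <= 1.
  apply: (@le_trans _ _ (\int[xi]_mu (cst 1 mu))).
    apply: ge0_le_integral => //; first exact: measurable_kernel.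
    move=> mu _; rewrite /= -(prob_kernel (s := P) mu).
    by apply: le_measure => //; rewrite inE.
  by rewrite integral_cst//= mul1e probability_setT.
have Ifin : \int[xi]_mu P mu A \is a fin_num.
  by rewrite ge0_fin_numE ?(le_lt_trans Ioo) ?ltry//; exact: ltW.
rewrite /posterior /= /mnormalize /= /joint.
have /andP[/negbTE I0' /negbTE Ioo'] :
    (\int[xi]_mu P mu A != 0) && (\int[xi]_mu P mu A != +oo).
  by rewrite (gt_eqF I0)/=; case: eqP Ifin => // ->.
rewrite I0' Ioo'/= -[in RHS](fineK Ifin) inver ifF//.
by rewrite -eqe (fineK Ifin) I0'.
Qed.

End joint.

Section kullback_leibler.
Local Open Scope ereal_scope.
Local Open Scope charge_scope.
Context d (T : measurableType d) (R : realType).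

(* D(p || q), with the usual value +oo when dp/dq does not exist. *)
Definition kl_divergence (p q : probability T R) : \bar R :=
  if `[< p `<< q >] then
    \int[p]_x lne (('d (charge_of_finite_measure p) '/d q) x)
  else +oo.

End kullback_leibler.

Definition abc_set (H : Type) (R : realType) (W : normedModType R)
    (f : H -> W) (h : H) (eps : R) : set H :=
  [set z | `|f z - f h| <= eps].

(* Main.v *)
(* On the acceptance set A every history has probability at most
   e^(L eps) P(h), so P(A) <= C P(h) with C = |A| e^(L eps), and P(h) <= P(A)
   since h is in A.  Integrating both bounds against the prior, the exact
   posterior is at most C times the ABC posterior on every measurable set, so its
   Radon-Nikodym derivative is at most C almost everywhere and the divergence
   is at most ln C = ln |A| + L eps. *)
Require Import Defs.
From HB Require Import structures.
From mathcomp Require Import all_boot all_order all_algebra.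
From mathcomp Require Import finmap.
From mathcomp Require Import all_classical all_reals all_analysis.
From mathcomp Require Import measurable_realfun.

Set Implicit Arguments.
Unset Strict Implicit.
Unset Printing Implicit Defensive.
Import Order.TTheory GRing.Theory Num.Theory.
Import numFieldNormedType.Exports.

Local Open Scope classical_set_scope.
Local Open Scope ring_scope.

Section measure_bound.
Local Open Scope ereal_scope.
Local Open Scope charge_scope.
Context d (T : measurableType d) (R : realType).

(** Needed for the integrand of [kl_divergence]. [lne] is piecewise: [-oo] on nonpositive values,
    [+oo] at [+oo], the real [ln] elsewhere; the conditions and the pieces are all measurable. *)
Lemma measurable_funT_lne (f : T -> \bar R) :
  measurable_fun [set: T] f -> measurable_fun [set: T] (fun x => lne (f x)).
Proof.
move=> mf.
have -> : (fun x => lne (f x)) = fun x => if f x <= 0 then -oo else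
    if f x == +oo then +oo else (ln (fine (f x)))%:E.
  by apply/funext => x; case: (f x) => [r| |] /=; rewrite ?lee_fin ?leye_eq ?leNye.
apply: measurable_fun_ifT => //; first exact: measurable_fun_lee.
apply: measurable_fun_ifT => //; first exact: measurable_fun_eqe.
apply/measurable_EFinP; apply: measurableT_comp => //.
exact: measurableT_comp (fine_measurable measurableT) mf.
Qed.

Lemma dominates_of_le (p q : probability T R) (C : R) :
  (forall B, measurable B -> p B <= C%:E * q B) -> p `<< q.
Proof.
move=> pq; apply/null_content_dominatesP => B mB qB0.
by apply/eqP; rewrite -measure_le0 (le_trans (pq _ mB))// qB0 mule0.
Qed.

(** Let [f] be the density and [N] the set where it exceeds [C]. Then [f - C] is positive on [N],
    while its [q]-integral over [N] is [p N - C * q N <= 0]; this forces [q N = 0]. *)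
Lemma Radon_Nikodym_le (p q : probability T R) (C : R) :
  (forall B, measurable B -> p B <= C%:E * q B) ->
  q [set x | C%:E < ('d (charge_of_finite_measure p) '/d q) x] = 0.
Proof.
move=> pq; have dom := dominates_of_le pq.
set f := 'd _ '/d _; set N := [set x | _].
have fi : q.-integrable setT f by exact: Radon_Nikodym_integrable.
have mN : measurable N.
  rewrite -[N]setTI; apply: emeasurable_fun_o_infty => //.
  exact: measurable_int fi.
have fiN : q.-integrable N f by apply: integrableS fi.
have CiN : q.-integrable N (cst C%:E).
  by apply: finite_measure_integrable_cst.
have fCi : q.-integrable N (f \- cst C%:E) by apply: integrableB.
have fC x : N x -> 0 < (f \- cst C%:E) x by move=> Nx; rewrite sube_gt0.
have fC0 : \int[q]_(x in N) `|(f \- cst C%:E) x| = 0.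
  rewrite (eq_integral (f \- cst C%:E)); last first.
    by move=> x /set_mem Nx; rewrite gee0_abs//; exact/ltW/fC.
  apply/eqP; rewrite eq_le; apply/andP; split; last first.
    by apply: integral_ge0 => x Nx; exact/ltW/fC.
  rewrite integralB// -Radon_Nikodym_integral// integral_cst//.
  by rewrite sube_le0; exact: pq.
(* A zero integral of the absolute value makes [f - C] vanish on [N] outside a null set [N']; as it
   vanishes nowhere on [N], all of [N] lies in [N']. *)
have [N' [mN' N'0 sub]] :=
  (ae_eq_integral_abs q mN (measurable_int _ fCi)).1 fC0.
apply: subset_measure0 N'0 => // x Nx; apply: sub => /= /(_ Nx) /eqP.
by apply/negP; rewrite gt_eqF//; exact: fC.
Qed.

(** The domination puts the divergence in its integral form, and the logarithm of the density is at
    most [ln C] outside a [p]-null set; [p] has mass 1. *)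
Lemma kl_divergence_le (p q : probability T R) (C : R) : (1 <= C)%R ->
  (forall B, measurable B -> p B <= C%:E * q B) ->
  kl_divergence p q <= (ln C)%:E.
Proof.
move=> C1 pq; have dom := dominates_of_le pq.
have C0 : (0 < C)%R by exact: lt_le_trans C1.
rewrite /kl_divergence asboolT//.
have := Radon_Nikodym_le pq; set f := 'd _ '/d _; set N := [set x | _] => qN0.
have mf : measurable_fun setT f.
  exact: measurable_int (Radon_Nikodym_integrable _).
have mN : measurable N by rewrite -[N]setTI; exact: emeasurable_fun_o_infty.
(* The divergence integrates against [p], so the [q]-null set has to be [p]-null as well. *)
have pN0 : p N = 0.
  by apply/eqP; rewrite -measure_le0 (le_trans (pq _ mN))// qN0 mule0.
have mlf : measurable_fun setT (fun x => lne (f x)).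
  exact: measurable_funT_lne.
(* Dropping the negative part avoids any integrability question for the logarithm. The positive part
   stays below [ln C] because [1 <= C] gives [0 <= ln C]. *)
rewrite integralE.
apply: (@le_trans _ _ (\int[p]_x ((fun x => lne (f x))^\+ x))).
  by rewrite geeDl// oppe_le0 integral_ge0.
apply: (@le_trans _ _ (\int[p]_x (cst (ln C)%:E x))); last first.
  by rewrite integral_cst// [X in _ * X]probability_setT mule1.
apply: ae_ge0_le_integral => //.
- exact: measurable_funepos.
- by move=> x _; rewrite lee_fin ln_ge0.
exists N; split=> // x /= /not_implyP[_ /negP]; rewrite -ltNge /N/=.
rewrite funeposE lt_max orbC ltNge lee_fin ln_ge0//= -lne_EFin//.
apply: contraTT; rewrite -!leNgt => fC.
have [fx0|fx0] := leP (f x) 0; first by rewrite le0_lneNy// leNye.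
by rewrite lee_lne// in_itv/= leey andbT ?lee_fin ltW.
Qed.

End measure_bound.

Section posterior_bound.
Local Open Scope ereal_scope.
Context d d' (M : measurableType d) (H : measurableType d') (R : realType).
Variables (xi : probability M R) (P : R.-pker M ~> H).

Lemma pker_le1 mu A : measurable A -> P mu A <= 1.
Proof.
move=> mA; rewrite -(prob_kernel (s := P) mu).
by apply: le_measure => //; rewrite inE.
Qed.

Lemma pker_fin_num mu A : measurable A -> P mu A \is a fin_num.
Proof.
by move=> mA; rewrite ge0_fin_numE// (le_lt_trans (pker_le1 mu mA))// ltry.
Qed.

(** A zero integral would make [P mu A] vanish for [xi]-almost every [mu]; being positive
    everywhere, it would make the whole space [xi]-null. *)
Lemma integral_pker_gt0 A : measurable A -> (forall mu, 0 < P mu A) ->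
  0 < \int[xi]_mu P mu A.
Proof.
move=> mA P0; rewrite lt_neqAle integral_ge0 ?andbT// eq_sym.
have mP : measurable_fun setT (P ^~ A) by exact: measurable_kernel.
apply/eqP => I0.
have : \int[xi]_mu `|P mu A| = 0.
  by rewrite -[RHS]I0; apply: eq_integral => mu _; rewrite gee0_abs.
move/(ae_eq_integral_abs _ measurableT mP) => [N [mN N0 sub]].
have : xi setT = 0.
  apply: subset_measure0 N0 => // mu _; apply: sub => /= /(_ I) /eqP.
  by rewrite gt_eqF.
by rewrite probability_setT => /eqP; rewrite onee_eq0.
Qed.

(** The two comparisons serve different places: the inclusion bounds the numerators over [B], and
    the factor [C] bounds the normalising constants. *)
Lemma posterior_le A A' (mA : measurable A) (mA' : measurable A') (C : R) B :
  A `<=` A' -> measurable B -> 0 < \int[xi]_mu P mu A ->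
  (forall mu, P mu A' <= C%:E * P mu A) ->
  posterior xi P mA B <= C%:E * posterior xi P mA' B.
Proof.
move=> AA' mB I0 PC.
have mP S (mS : measurable S) D (mD : measurable D) :
  measurable_fun D (P ^~ S) by apply: measurable_funTS; exact: measurable_kernel.
have leP D : measurable D ->
    \int[xi]_(mu in D) P mu A <= \int[xi]_(mu in D) P mu A'.
  move=> mD; apply: ge0_le_integral => //; try exact: mP.
  by move=> mu _; apply: le_measure => //; rewrite inE.
have Ifin S : measurable S -> \int[xi]_mu P mu S \is a fin_num.
  move=> mS; rewrite ge0_fin_numE ?integral_ge0//.
  apply: (@le_lt_trans _ _ (\int[xi]_mu (cst 1 mu))).
    apply: ge0_le_integral => //; first exact: mP.
    by move=> mu _; exact: pker_le1.
  by rewrite integral_cst// mul1e [X in X < _]probability_setT ltry.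
have I'0 : 0 < \int[xi]_mu P mu A' by apply: lt_le_trans I0 (leP _ _).
have IC : \int[xi]_mu P mu A' <= C%:E * \int[xi]_mu P mu A.
  have PAi : xi.-integrable setT (P ^~ A).
    apply: (le_integrable measurableT (mP _ mA _ measurableT)); last first.
      exact: (finite_measure_integrable_cst xi 1%R measurableT).
    by move=> mu _; rewrite gee0_abs//= normr1 pker_le1.
  rewrite -integralZl//; apply: ge0_le_integral => //; first exact: mP.
  by apply: emeasurable_funM => //; exact: mP.
have IBfin S : measurable S -> \int[xi]_(mu in B) P mu S \is a fin_num.
  move=> mS; rewrite ge0_fin_numE ?integral_ge0//.
  apply: (@le_lt_trans _ _ (\int[xi]_mu P mu S)).
    by apply: ge0_subset_integral => //; exact: mP.
  by rewrite -ge0_fin_numE ?Ifin// integral_ge0.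
have := leP B mB.
rewrite !posteriorE//; move: I0 I'0 IC.
rewrite -(fineK (Ifin _ mA)) -(fineK (Ifin _ mA')).
rewrite -(fineK (IBfin _ mA)) -(fineK (IBfin _ mA')).
have a'0 : (0 <= fine (\int[xi]_(mu in B) P mu A'))%R.
  by rewrite fine_ge0// integral_ge0.
set Z := fine _; set Z' := fine _; set a := fine _; set a' := fine _.
rewrite !lte_fin => Z0 Z'0; rewrite -EFinM !lee_fin => ZC aa'.
rewrite !inver !gt_eqF// -!EFinM lee_fin.
(* The chain is [a / Z <= a' / Z <= C * (a' / Z')], from [a <= a'] and then [Z' <= C * Z]. *)
apply: (@le_trans _ _ (a' / Z)%R); first by rewrite ler_pM2r// invr_gt0.
by rewrite mulrCA ler_wpM2l// ler_pdivlMr// mulrC ler_pdivrMr.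
Qed.

End posterior_bound.

(** Finite subadditivity over the cover of [S] by its singletons. *)
Lemma fin_measure_le_card d (H : measurableType d) (R : realType)
    (mu : {measure set H -> \bar R}) (S : set H) (c : R) :
  (forall z : H, measurable [set z]) -> finite_set S -> measurable S ->
  (forall z, S z -> mu [set z] <= c%:E)%E ->
  (mu S <= (#|` fset_set S|%:R * c)%:E)%E.
Proof.
move=> m1 finS mS muc.
apply: (le_trans (@content_sub_fsum _ _ _ mu _ S S set1 finS _ mS _)) => //.
  by move=> z Sz; exists z.
rewrite fsbig_finite//= big_seq.
apply: (@le_trans _ _ (\sum_(z <- fset_set S | z \in fset_set S) c%:E)%E).
  by apply: lee_sum => z; rewrite in_fset_set// => /set_mem; exact: muc.
by rewrite -big_seq sumEFin big_const_seq count_predT iter_addr_0 mulr_natl.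
Qed.

Lemma le_expR_of_abs_ln_div (R : realType) (x y c : R) : 0 < x -> 0 < y ->
  `|ln (y / x)| <= c -> y <= expR c * x.
Proof.
move=> x0 y0 /(le_trans (ler_norm _)).
by rewrite -ler_pdivrMr// -[X in _ -> X <= _]lnK ?posrE ?divr_gt0// ler_expR.
Qed.

Theorem theorem2p1 (R : realType)
    (d d' : measure_display) (M : measurableType d) (H : measurableType d')
    (countH : countable [set: H])
    (discreteH : forall A : set H, measurable A)
    (xi : probability M R)
    (Policy : Type) (P : Policy -> R.-pker M ~> H) (pol : Policy)
    (W : normedModType R) (f : H -> W)
    (L : R) (L_gt0 : 0 < L)
    (P_gt0 : forall (mu : M) (z : H), (0 < P pol mu [set z])%E)
    (P_lip : forall (mu : M) (x z : H),
      `|ln (fine (P pol mu [set z]) / fine (P pol mu [set x]))|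
        <= L * `|f z - f x|)
    (h : H) (eps : R) (eps_gt0 : 0 < eps) :
  (kl_divergence (posterior xi (P pol) (discreteH [set h]))
                 (posterior xi (P pol) (discreteH (abc_set f h eps)))
   <= lne (counting (abc_set f h eps)) + (2 * L * eps)%:E)%E.
Proof.
set A := abc_set f h eps; set K := expR (L * eps).
have m1 (z : H) : measurable [set z] by [].
have Ah : A h by rewrite /A /abc_set /= subrr normr0 ltW.
have Ph0 mu : 0 < fine (P pol mu [set h]).
  by rewrite fine_gt0// P_gt0 ltey_eq pker_fin_num.
(* The Lipschitz hypothesis is applied with [x := h], where membership in [A] bounds the distance by
   [eps]. *)
have PK mu z : A z -> (P pol mu [set z] <= (K * fine (P pol mu [set h]))%:E)%E.
  move=> Az; rewrite -(fineK (pker_fin_num (P pol) mu (m1 z))) lee_fin.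
  apply: le_expR_of_abs_ln_div => //.
    by rewrite fine_gt0// P_gt0 ltey_eq pker_fin_num.
  by rewrite (le_trans (P_lip _ _ _))// ler_pM2l.
(* For infinite [A], [counting] is [+oo], and so is the right-hand side. *)
have [finA|infA] := pselect (finite_set A); last first.
  by rewrite /counting asboolF//= addye// leey.
set n := #|` fset_set A|.
(* Since [h] is in [A], the count is nonzero: [ln n] is a genuine logarithm and [n * K >= 1], as
   [kl_divergence_le] requires. *)
have n1 : 1 <= n%:R :> R.
  rewrite ler1n cardfs_gt0; apply/fset0Pn; exists h.
  by rewrite in_fset_set// inE.
have K1 : 1 <= K by rewrite -expR0 ler_expR ltW// mulr_gt0.
rewrite /counting asboolT// -/n lne_EFin ?(lt_le_trans ltr01)//.
apply: (@le_trans _ _ (ln (n%:R * K))%:E).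
  apply: kl_divergence_le; first by rewrite (le_trans n1)// ler_peMr.
  move=> B mB; apply: posterior_le => //.
  - by move=> z ->.
  - by apply: integral_pker_gt0 => // mu; exact: P_gt0.
  move=> mu; rewrite -(fineK (pker_fin_num (P pol) mu (m1 h))) -EFinM -mulrA.
  by apply: fin_measure_le_card => // z; exact: PK.
(* [ln (n * K)] is [ln n + L * eps], and [L * eps <= 2 * L * eps] by positivity. *)
rewrite -EFinD lee_fin lnM ?posrE ?expR_gt0 ?(lt_le_trans ltr01)//.
by rewrite expRK lerD2l -mulrA ler_peMl ?ler1n// ltW// mulr_gt0.
Qed.
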